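(* Let $X$ be a real Banach space. If $X^*$ is fully Mackey complete, then $X$ is $w^*$-sequentially dense in $X^{**}$, i.e. every element of $X^{**}$ is the $w^*$-limit of a sequence in $X$.
   Context: For a Banach space $Z$, a linear subspace $Y\subset Z^*$ is norming if $|||z|||=\sup\{z^*(z): z^*\in Y,\ \|z^*\|\le 1\}$ defines an equivalent norm on $Z$. $Z$ is fully Mackey complete if $(Z,\mu(Z,Y))$ is complete for every norming and norm-closed subspace $Y\subset Z^*$, where $\mu(Z,Y)$ is the locally convex topology on $Z$ of uniform convergence on absolutely convex $w^*$-compact subsets of $Y$. Here this is applied with $Z=X^*$. *)

(* Defs.v *)
From HB Require Import structures.
From mathcomp Require Import all_boot all_order all_algebra.
From mathcomp Require Import all_classical all_reals all_analysis.
Set Implicit Arguments. Unset Strict Implicit. Unset Printing Implicit Defensive.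
Import Order.TTheory GRing.Theory Num.Theory.
Import numFieldNormedType.Exports.
Local Open Scope classical_set_scope.
Local Open Scope ring_scope.

Section Duality.
Variables (R : realType) (X : normedModType R).

Definition is_dual (f : X -> R) : Prop :=
  (forall (a : R) (x y : X), f (a *: x + y) = a * f x + f y) /\ continuous f.

Definition dualT : Type := {f : X -> R | is_dual f}.

Definition dnorm (f : dualT) : R :=
  sup [set `|sval f x| | x in [set x : X | `|x| <= 1]].

Definition is_bidual (phi : dualT -> R) : Prop :=
  (forall (a : R) (f g h : dualT),
      (forall x, sval h x = a * sval f x + sval g x) ->
      phi h = a * phi f + phi g) /\
  (exists C : R, forall f : dualT, `|phi f| <= C * dnorm f).

Definition bnorm (phi : dualT -> R) : R :=
  sup [set `|phi f| | f in [set f : dualT | dnorm f <= 1]].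

Definition bidual_subspace (Y : set (dualT -> R)) : Prop :=
  Y `<=` is_bidual /\ Y (fun _ => 0) /\
  (forall (a : R) (phi psi : dualT -> R), Y phi -> Y psi ->
     Y (fun f => a * phi f + psi f)).

Definition norm_closed (Y : set (dualT -> R)) : Prop :=
  forall phi : dualT -> R, is_bidual phi ->
    (forall eps : R, 0 < eps ->
       exists2 psi, Y psi & bnorm (fun f => phi f - psi f) <= eps) ->
    Y phi.

Definition norming (Y : set (dualT -> R)) : Prop :=
  exists c C : R, 0 < c /\ 0 < C /\
    forall z : dualT,
      c * dnorm z <= sup [set phi z | phi in [set phi | Y phi /\ bnorm phi <= 1]]
      /\ sup [set phi z | phi in [set phi | Y phi /\ bnorm phi <= 1]] <= C * dnorm z.

Definition abs_convex (K : set (dualT -> R)) : Prop :=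
  forall (a b : R) (phi psi : dualT -> R), K phi -> K psi ->
    `|a| + `|b| <= 1 -> K (fun f => a * phi f + b * psi f).

(* absolutely convex, w*-compact subsets of Y; the w*-topology on Z^* is the
   topology of pointwise convergence on Z = dualT *)
Definition mackey_sets (Y : set (dualT -> R)) (K : set (dualT -> R)) : Prop :=
  K `<=` Y /\ abs_convex K /\ @compact {ptws dualT -> R} K.

(* (Z, mu(Z,Y)) is complete: every proper Cauchy filter converges, where the
   uniformity of mu(Z,Y) is given by the seminorms p_K(z) = sup_{phi in K} |phi z|,
   K ranging over the absolutely convex w*-compact subsets of Y.
   (phi (z1 - z2) = phi z1 - phi z2 by linearity of phi.) *)
Definition mackey_complete (Y : set (dualT -> R)) : Prop :=
  forall F : set_system dualT, ProperFilter F ->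
    (forall K, mackey_sets Y K -> forall eps : R, 0 < eps ->
       exists2 A, F A & forall z1 z2, A z1 -> A z2 ->
         forall phi, K phi -> `|phi z1 - phi z2| <= eps) ->
    exists z0 : dualT, forall K, mackey_sets Y K -> forall eps : R, 0 < eps ->
       F [set z | forall phi, K phi -> `|phi z - phi z0| <= eps].

End Duality.

Definition dual_fully_mackey_complete (R : realType) (X : normedModType R) : Prop :=
  forall Y : set (dualT X -> R),
    bidual_subspace Y -> norm_closed Y -> norming Y -> mackey_complete Y.

(* Main.v *)
Require Import Defs.
From HB Require Import structures.
From mathcomp Require Import all_boot all_order all_algebra.
From mathcomp Require Import all_classical all_reals all_analysis.
From mathcomp Require Import ring lra.
Set Implicit Arguments. Unset Strict Implicit. Unset Printing Implicit Defensive.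
Import Order.TTheory GRing.Theory Num.Theory.
Import numFieldNormedType.Exports.
Local Open Scope classical_set_scope.
Local Open Scope ring_scope.

(** Suppose [phi] in [X**] is not the w*-limit of a sequence in [X]. Then
[Y := X + R phi] is a norm closed norming subspace of [X**]; let [theta] be the linear
form on [Y] reading off the [phi]-coefficient. On every absolutely convex w*-compact
[K] in [Y], [theta] is a uniform limit of elements of [X*]. Otherwise a finite-dimensional
Lagrange multiplier argument yields [y] in [K] outside of [X] that agrees with an element
of [K] in [X] on any given finite subset of [X*]; choosing such elements and functionals
alternately, as in Whitley's proof of the Eberlein-Smulian theorem, gives a sequence
[a] in [K] and [X] with a cluster point [z] outside of [X]. A cluster point of [a] that
agrees with [z] on a suitable countable subset of [X*] equals [z], so a subsequence of [a]
converges to [z], and [phi] is a w*-limit of a sequence as well. The uniform approximations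
of [theta] thus generate a [mu(X*, Y)]-Cauchy filter on [X*]. Its limit would be an element
of [X*] inducing [theta], which vanishes on [X] but not at [phi]. *)

(** * Hahn-Banach theorem *)

Section HahnBanach.
Variables (R : realType) (V : lmodType R).
Implicit Types (p q : V -> R) (x y z : V).

(** Positive homogeneity is asked only as an inequality, which infima satisfy directly; [sublinearZ]
    recovers equality. *)
Definition sublinear p :=
  (forall x y, p (x + y) <= p x + p y) /\
  (forall (a : R) x, 0 <= a -> p (a *: x) <= a * p x).

Lemma sublinear0 p : sublinear p -> p 0 = 0.
Proof.
move=> [pD pZ]; have := pD 0 0; have := pZ 0 0 (lexx _).
by rewrite addr0 scale0r mul0r => *; lra.
Qed.

Lemma sublinearZ p (a : R) x : sublinear p -> 0 <= a -> p (a *: x) = a * p x.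
Proof.
move=> sp; have [_ pZ] := sp.
rewrite le_eqVlt => /predU1P[<-|a0]; first by rewrite scale0r mul0r sublinear0.
apply/eqP; rewrite eq_le (pZ _ _ (ltW a0))/=.
have := pZ a^-1 (a *: x); rewrite invr_ge0 (ltW a0) => /(_ isT).
by rewrite scalerA mulVf ?gt_eqF// scale1r ler_pdivlMl.
Qed.

Lemma sublinear_lb p x : sublinear p -> - p (- x) <= p x.
Proof.
move=> sp; have [pD _] := sp; have := pD x (- x).
by rewrite subrr sublinear0// => *; lra.
Qed.

Definition shift_values q y x : set R :=
  [set q (x + t *: y) - t * q y | t in [set t | 0 <= t]].

(* The largest sublinear minorant of [q] that is at most [- q y] at [- y]. *)
Definition shift q y x := inf (shift_values q y x).

(** Subadditivity gives [t * q y <= q (x + t *: y) + q (- x)], so [- q (- x)] is a lower bound. *)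
Lemma shift_values_has_inf q y x : sublinear q -> has_inf (shift_values q y x).
Proof.
move=> sq; have [qD qZ] := sq; split; first by exists (q (x + 0 *: y) - 0 * q y), 0 => /=.
exists (- q (- x)) => _ [t /= t0 <-].
have := qD (x + t *: y) (- x); rewrite addrAC subrr add0r sublinearZ// => *; lra.
Qed.

Lemma shift_le q y x (t : R) : sublinear q -> 0 <= t ->
  shift q y x <= q (x + t *: y) - t * q y.
Proof.
by move=> sq t0; apply: ge_inf; [exact: (shift_values_has_inf y x sq).2|exists t].
Qed.

Lemma shift_le_self q y x : sublinear q -> shift q y x <= q x.
Proof. by move=> sq; have := shift_le y x sq (lexx 0); rewrite scale0r addr0 mul0r subr0. Qed.

(** Near-optimal parameters for [x1] and [x2] add up to an admissible one for [x1 + x2]; for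
    [a > 0], the parameter [t] at [x] corresponds to [a * t] at [a *: x]. *)
Lemma sublinear_shift q y : sublinear q -> sublinear (shift q y).
Proof.
move=> sq; have [qD qZ] := sq; split=> [x1 x2|a x].
- apply/ler_addgt0Pr => e e0; have e20 : 0 < e / 2 by lra.
  have [_ [t1 /= t10 <-] h1] := inf_adherent e20 (shift_values_has_inf y x1 sq).
  have [_ [t2 /= t20 <-] h2] := inf_adherent e20 (shift_values_has_inf y x2 sq).
  have := shift_le y (x1 + x2) sq (addr_ge0 t10 t20).
  have := qD (x1 + t1 *: y) (x2 + t2 *: y).
  rewrite addrACA -scalerDl -/(shift q y x1) -/(shift q y x2) in h1 h2 * => *.
  lra.
- rewrite le_eqVlt => /predU1P[<-|a0].
    by rewrite scale0r mul0r (le_trans (shift_le_self _ _ sq))// sublinear0.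
  rewrite -ler_pdivrMl//; apply: lb_le_inf; first exact: (shift_values_has_inf y x sq).1.
  move=> _ [t /= t0 <-]; rewrite ler_pdivrMl//.
  have := shift_le y (a *: x) sq (mulr_ge0 (ltW a0) t0).
  by rewrite -scalerA -scalerDr (sublinearZ _ sq (ltW a0)) mulrBr mulrA.
Qed.

(** Minimality forces [shift q y = q] for every [y]; the parameter [t = 1] then gives
    [q x + q y <= q (x + y)]. *)
Lemma minimal_sublinear_linear q : sublinear q ->
  (forall p, sublinear p -> (forall x, p x <= q x) -> p = q) ->
  forall (a : R) x y, q (a *: x + y) = a * q x + q y.
Proof.
move=> sq qmin.
have qD x y : q (x + y) = q x + q y.
  apply/eqP; rewrite eq_le sq.1/=.
  have := shift_le y x sq ler01; rewrite scale1r mul1r.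
  by rewrite (qmin _ (sublinear_shift y sq) (fun z => shift_le_self y z sq)); lra.
have qN x : q (- x) = - q x.
  by have := qD x (- x); rewrite subrr sublinear0//; lra.
move=> a x y; rewrite qD; congr (_ + _).
have [a0|/ltW a0] := leP 0 a; first exact: sublinearZ.
by rewrite -[a]opprK scaleNr qN sublinearZ ?mulNr// oppr_ge0.
Qed.

(** Zorn's lemma. A nonempty chain is bounded by its pointwise infimum, which is finite since
    [- p (- x) <= q x], and subadditive since the smaller of two near-minimisers serves both
    points. *)
Lemma exists_minimal_sublinear p : sublinear p ->
  exists2 q, sublinear q /\ (forall x, q x <= p x) &
    forall r, sublinear r -> (forall x, r x <= q x) -> r = q.
Proof.
move=> sp.
pose T := {q : V -> R | sublinear q /\ forall x, q x <= p x}.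
(* The order is reversed: maximal for [r] means pointwise minimal. *)
pose r (q1 q2 : T) := `[< forall x, sval q2 x <= sval q1 x >].
have [||||[q [sq qp]] qmin] := @Zorn T r.
- by move=> q; apply/asboolP.
- move=> q1 q2 q3 /asboolP h1 /asboolP h2; apply/asboolP => x.
  exact: le_trans (h1 x).
- move=> [q1 h1] [q2 h2] /asboolP /= h12 /asboolP /= h21.
  have e : q1 = q2 by apply/funext => x; apply/eqP; rewrite eq_le h12 h21.
  by subst q2; congr exist; exact: Prop_irrelevance.
- move=> A Atot; have [[q0 Aq0]|A0] := pselect (A !=set0); last first.
    by exists (exist _ p (conj sp (fun x => lexx _))) => s As; case: A0; exists s.
  pose E x : set R := [set sval q x | q in A].
  have Einf x : has_inf (E x).
    split; first by exists (sval q0 x), q0.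
    exists (- p (- x)) => _ [[q [sq qp]] Aq <-] /=.
    by apply: le_trans (sublinear_lb x sq); rewrite lerN2.
  have Ele x (q : T) : A q -> inf (E x) <= sval q x.
    by move=> Aq; apply: ge_inf; [exact: (Einf x).2|exists q].
  have sE : sublinear (fun x => inf (E x)).
    split=> [x y|a x a0].
    + apply/ler_addgt0Pr => e e0; have e20 : 0 < e / 2 by lra.
      have [_ [q1 A1 <-] h1] := inf_adherent e20 (Einf x).
      have [_ [q2 A2 <-] h2] := inf_adherent e20 (Einf y).
      have [/asboolP h|/asboolP h] := Atot _ _ A1 A2.
        have := Ele (x + y) _ A2; have := (svalP q2).1.1 x y; have := h x; lra.
      have := Ele (x + y) _ A1; have := (svalP q1).1.1 x y; have := h y; lra.
    + move: a0; rewrite le_eqVlt => /predU1P[<-|a0].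
        rewrite scale0r mul0r (le_trans (Ele _ _ Aq0))//.
        by rewrite sublinear0//; exact: (svalP q0).1.
      rewrite -ler_pdivrMl//; apply: lb_le_inf; first exact: (Einf x).1.
      move=> _ [q Aq <-]; rewrite ler_pdivrMl//.
      by rewrite -(sublinearZ _ (svalP q).1 (ltW a0)); exact: Ele.
  have Ep x : inf (E x) <= p x by exact: le_trans (Ele x _ Aq0) ((svalP q0).2 x).
  by exists (exist _ (fun x => inf (E x)) (conj sE Ep)) => q Aq; apply/asboolP => x /=; exact: Ele.
exists q => // q' sq' q'q.
have q'p x : q' x <= p x by exact: le_trans (qp x).
pose t' : T := exist _ q' (conj sq' q'p).
by have /(congr1 sval) : t' = exist _ q (conj sq qp) by apply/qmin/asboolP.
Qed.

(** A minimal sublinear [q] below [shift p x] is linear, and [q (- x) <= shift p x (- x) <= - p x]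
    yields [p x <= q x]. *)
Lemma hahn_banach p x : sublinear p ->
  exists f : V -> R, [/\ forall (a : R) y z, f (a *: y + z) = a * f y + f z,
    forall y, f y <= p y & f x = p x].
Proof.
move=> sp; have [q [sq qp] qmin] := exists_minimal_sublinear (sublinear_shift x sp).
have qlin := minimal_sublinear_linear sq qmin.
have qlep y : q y <= p y by exact: le_trans (qp y) (shift_le_self x y sp).
exists q; split=> //.
apply/eqP; rewrite eq_le qlep /=.
have := shift_le x (- x) sp ler01; have := qp (- x).
have := qlin (-1) x 0.
by rewrite scaleN1r scale1r mul1r addr0 addNr !sublinear0//; lra.
Qed.

End HahnBanach.

(** * Approximate Lagrange multipliers *)

Section ApproximateLagrange.
Variables (R : realType) (T : Type) (comb : R -> R -> T -> T -> T).
Implicit Types (K : set T) (g : T -> R).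

(** Absolute convexity for an abstract combination [comb], so that the multiplier argument serves
    both subsets of the dual and sets of functions on the dual. *)
Definition comb_closed K := forall (a b : R) u v,
  K u -> K v -> `|a| + `|b| <= 1 -> K (comb a b u v).

Definition linear_on K g := forall (a b : R) u v,
  K u -> K v -> `|a| + `|b| <= 1 -> g (comb a b u v) = a * g u + b * g v.

Lemma linear_onS K K' g : K' `<=` K -> linear_on K g -> linear_on K' g.
Proof. by move=> KK' gK a b u v /KK' Ku /KK' Kv; exact: gK. Qed.

(** For [h u > 0] the admissible [lam] form the interval from [(g u - eps) / h u] to
    [(g u + eps) / h u]. By [key] every left endpoint is below every right one, so the supremum of
    the left endpoints lies in all intervals; [flip] handles [h u < 0]. *)
Lemma approx_lagrange1 K g h (eps : R) :
  comb_closed K -> linear_on K g -> linear_on K h ->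
  (forall u, K u -> h u = 0 -> `|g u| <= eps) ->
  exists lam, forall u, K u -> `|g u - lam * h u| <= eps.
Proof.
move=> Kc gl hl gh.
have flip u : K u -> exists u', [/\ K u', g u' = - g u & h u' = - h u].
  move=> Ku; have c : `|-1 : R| + `|0 : R| <= 1 by rewrite normrN1 normr0 addr0.
  exists (comb (-1) 0 u u); split; [exact: Kc|rewrite gl//; lra|rewrite hl//; lra].
have [[u0 [Ku0 hu0]]|h0] := pselect (exists u, K u /\ h u != 0); last first.
  exists 0 => u Ku; rewrite mul0r subr0; apply: gh => //.
  by apply/eqP/negPn/negP => hu; apply: h0; exists u.
have [w [Kw hw]] : exists w, K w /\ 0 < h w.
  have [hu|hu] := ltP 0 (h u0); first by exists u0.
  have [u' [Ku' _ hu']] := flip _ Ku0; exists u'; split=> //.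
  by rewrite hu' oppr_gt0 lt_neqAle hu0.
(* for [h u, h v > 0] the combination [(h v u - h u v) / (h u + h v)] kills [h] *)
have key u v : K u -> K v -> 0 < h u -> 0 < h v ->
    (g u - eps) / h u <= (g v + eps) / h v.
  move=> Ku Kv hu hv.
  have s0 : 0 < h u + h v by lra.
  pose a := h v / (h u + h v); pose b := - (h u / (h u + h v)).
  have ab : `|a| + `|b| <= 1.
    rewrite normrN !ger0_norm; try by apply: divr_ge0; lra.
    by rewrite -mulrDl addrC divff// gt_eqF.
  have hc : h (comb a b u v) = 0 by rewrite hl// /a /b; field; lra.
  have := gh _ (Kc _ _ _ _ Ku Kv ab) hc; rewrite gl// => /ler_normlP[_].
  have -> : a * g u + b * g v = (h v * g u - h u * g v) / (h u + h v).
    by rewrite /a /b; field; lra.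
  rewrite ler_pdivrMr// ler_pdivrMr// mulrAC ler_pdivlMr//; nra.
pose S := [set (g u - eps) / h u | u in [set u | K u /\ 0 < h u]].
have Ssup : has_sup S.
  split; first by exists ((g w - eps) / h w), w.
  by exists ((g w + eps) / h w) => _ [u [Ku hu] <-]; exact: key.
have pos u : K u -> 0 < h u -> `|g u - sup S * h u| <= eps.
  move=> Ku hu.
  have : (g u - eps) / h u <= sup S by apply: ub_le_sup; [exact: Ssup.2|exists u].
  have : sup S <= (g u + eps) / h u.
    by apply: ge_sup; [exact: Ssup.1|move=> _ [v [Kv hv] <-]; exact: key].
  rewrite ler_pdivrMr// ler_pdivlMr// => *; apply/ler_normlP; split; lra.
exists (sup S) => u Ku.
have [hu|hu|hu] := ltgtP 0 (h u); first exact: pos.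
- have [u' [Ku' gu' hu']] := flip _ Ku.
  have := pos u' Ku'; rewrite hu' gu' oppr_gt0 => /(_ hu).
  by rewrite mulrN -opprD normrN.
- by rewrite -hu mulr0 subr0; apply: gh.
Qed.

(** Approximate form of the fact that a form vanishing on a common kernel is a combination of the
    given forms. Induction on the number of constraints: the last one is first built into [K], then
    removed by [approx_lagrange1] applied to [g - e z]. *)
Lemma approx_lagrange (E : Type) (e : E -> T -> R) (P : set E) (x : nat -> E)
    (eps : R) (n : nat) K g :
  (exists2 z, P z & forall u, K u -> e z u = 0) ->
  (forall (a : R) y z, P y -> P z ->
     exists2 w, P w & forall u, K u -> e w u = a * e y u + e z u) ->
  (forall y, linear_on K (e y)) ->
  (forall i, (i < n)%N -> P (x i)) ->
  comb_closed K -> linear_on K g ->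
  (forall u, K u -> (forall i, (i < n)%N -> e (x i) u = 0) -> `|g u| <= eps) ->
  exists2 z, P z & forall u, K u -> `|g u - e z u| <= eps.
Proof.
elim: n K g => [|n IH] K g P0 PD el Px Kc gl gx.
  have [z Pz ez] := P0; exists z => // u Ku; rewrite ez// subr0; exact: gx.
pose K' := K `&` [set u | e (x n) u = 0].
have K'K : K' `<=` K by move=> ? [].
have [|||||||z Pz hz] := IH K' g.
- by have [z Pz ez] := P0; exists z => // u /K'K; exact: ez.
- by move=> a y z Py Pz; have [w Pw ew] := PD a _ _ Py Pz; exists w => // u /K'K; exact: ew.
- by move=> y; exact: linear_onS (el y).
- by move=> i i_n; apply: Px; exact: ltnW.
- move=> a b u v [Ku xu] [Kv xv] ab; split; first exact: Kc.
  by rewrite /= el// xu xv !mulr0 addr0.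
- exact: linear_onS gl.
- move=> u [Ku xu] hu; apply: gx => // i; rewrite ltnS leq_eqVlt => /predU1P[->//|].
  exact: hu.
have [|||lam hlam] := @approx_lagrange1 K (fun u => g u - e z u) (e (x n)) eps Kc.
- by move=> a b u v Ku Kv ab; rewrite gl// el//; ring.
- exact: el.
- by move=> u Ku xu; apply: hz.
have [w Pw ew] := PD lam (x n) z (Px _ (ltnSn _)) Pz.
by exists w => // u Ku; rewrite ew// [_ * _ + _]addrC opprD addrA; exact: hlam.
Qed.

End ApproximateLagrange.

(** * Limits along ultrafilters *)

Lemma ultra_fmap (T U : Type) (f : T -> U) (F : set_system T) :
  UltraFilter F -> UltraFilter (f @ F).
Proof.
move=> FU; split=> [|G GF FG]; first exact: fmap_proper_filter.
apply/seteqP; split=> [A GA|]; last exact: FG.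
have [//|FnA] := in_ultra_setVsetC (f @^-1` A) FU.
have GnA : G (~` A) by exact: FG.
by have /filter_ex[? []] : G (A `&` ~` A) by exact: filterI.
Qed.

Lemma ultra_compact_cvg (T : Type) (V : topologicalType) (F : set_system T)
    (K : set V) (y : T -> V) :
  UltraFilter F -> compact K -> (forall t, K (y t)) ->
  exists2 z, K z & y @ F --> z.
Proof.
move=> FU; rewrite compact_ultra => Kc Ky.
have [||z [Kz yz]] := Kc (y @ F); [exact: ultra_fmap| |by exists z].
by apply: (@filterS _ F _ setT); [move=> t _; exact: Ky|exact: filterT].
Qed.

Lemma ultra_bounded_cvg (R : realType) (T : Type) (F : set_system T)
    (u : T -> R) (C : R) :
  UltraFilter F -> (forall t, `|u t| <= C) -> exists l : R, u @ F --> l.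
Proof.
move=> FU uC.
have [|l _ ul] := ultra_compact_cvg FU (@segment_compact R (- C) C) (y := u).
  by move=> t /=; rewrite in_itv /= -ler_norml.
by exists l.
Qed.

Lemma ultra_eventually : exists2 U : set_system nat,
  UltraFilter U & forall n, U [set m | (n <= m)%N].
Proof.
have [U [UU sU]] := ultraFilterLemma eventually_filter.
by exists U => // n; apply: sU; exact: nbhs_infty_ge.
Qed.

(** If the preimage of a neighbourhood is not in [F], its complement meets every member of [F], and
    an ultrafilter containing [F] and that complement contradicts the hypothesis. *)
Lemma cvg_ultraP (T : Type) (V : topologicalType) (F : set_system T) (y : T -> V) (z : V) :
  Filter F -> (forall U, UltraFilter U -> F `<=` U -> y @ U --> z) -> y @ F --> z.
Proof.
move=> FF yU A Az; apply: contrapT; rewrite /= -[nbhs _ _]/(F (y @^-1` A)) => FA.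
pose G := filter_from F (fun B => B `&` ~` (y @^-1` A)).
have GP : ProperFilter G.
  apply: filter_from_proper.
    apply: filter_from_filter; first by exists setT; exact: filterT.
    move=> B C FB FC; exists (B `&` C); first exact: filterI.
    by move=> t [[? ?] ?].
  move=> B FB; apply: contrapT => B0; apply: FA; apply: (filterS _ FB) => t Bt.
  by apply: contrapT => nA; apply: B0; exists t.
have [U [UU GU]] := ultraFilterLemma GP.
have FU : F `<=` U by move=> B FB; apply: GU; exists B => // t [].
have UA := yU U UU FU A Az.
have UnA : U (~` (y @^-1` A)) by apply: GU; exists setT; [exact: filterT|move=> t []].
by have /filter_ex[? []] : U (y @^-1` A `&` ~` (y @^-1` A)) by exact: filterI.
Qed.

(** * Dual and bidual *)

Section Dual.
Variables (R : realType) (X : normedModType R).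
Implicit Types (f g h : dualT X) (phi psi : dualT X -> R) (x y : X).

Lemma dualP f (a : R) x y : sval f (a *: x + y) = a * sval f x + sval f y.
Proof. exact: (svalP f).1. Qed.

Lemma dual0 f : sval f 0 = 0.
Proof. by have := dualP f 1 0 0; rewrite scale1r addr0; lra. Qed.

Lemma dualZ f (a : R) x : sval f (a *: x) = a * sval f x.
Proof. by rewrite -[a *: x]addr0 dualP dual0 addr0. Qed.

Lemma dualD f x y : sval f (x + y) = sval f x + sval f y.
Proof. by rewrite -[x]scale1r dualP mul1r scale1r. Qed.

Lemma dualB f x y : sval f (x - y) = sval f x - sval f y.
Proof. by rewrite dualD -scaleN1r dualZ mulN1r. Qed.

Lemma dual_eq f g : (forall x, sval f x = sval g x) -> f = g.
Proof.
case: f g => [f f1] [g g1] /= fg; have e : f = g by exact/funext.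
by subst g; congr exist; exact: Prop_irrelevance.
Qed.

Lemma bounded_is_dual (f : X -> R) (C : R) :
  (forall (a : R) x y, f (a *: x + y) = a * f x + f y) ->
  (forall x, `|f x| <= C * `|x|) -> is_dual f.
Proof.
move=> fl fC; split=> //.
pose F : {linear X -> R^o} := HB.pack f (GRing.isLinear.Build _ _ _ _ f fl).
apply: (@bounded_linear_continuous _ _ _ F); apply/linear_boundedP.
by near=> r => x; apply: le_trans (fC x) _; rewrite ler_wpM2r.
Unshelve. all: by end_near. Qed.

Lemma dual_bounded f : exists2 C : R, 0 < C & forall x, `|sval f x| <= C * `|x|.
Proof.
have [fl fc] := svalP f.
pose F : {linear X -> R^o} := HB.pack (sval f) (GRing.isLinear.Build _ _ _ _ (sval f) fl).
have /linear_boundedP/pinfty_ex_gt0[C C0 hC] :=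
  @continuous_linear_bounded _ _ _ 0 F (fc 0).
by exists C.
Qed.

Definition mk_dual (f : X -> R) (fd : is_dual f) : dualT X := exist _ f fd.

Lemma is_dual_comb (a b : R) f g : is_dual (fun x => a * sval f x + b * sval g x).
Proof.
have [C C0 fC] := dual_bounded f; have [D D0 gD] := dual_bounded g.
apply: (@bounded_is_dual _ (`|a| * C + `|b| * D)) => [c x y|x].
  by rewrite !dualP; ring.
rewrite (le_trans (ler_normD _ _))// !normrM mulrDl -!mulrA.
by apply: lerD; apply: ler_wpM2l.
Qed.

(** [dualT X] is a bare sigma type without vector space operations; linear algebra on it goes
    through this two-term combination. *)
Definition dual_comb (a b : R) f g := mk_dual (is_dual_comb a b f g).

Definition dual_ball : set (dualT X) := [set f | forall x, `|sval f x| <= `|x|].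

(** A norm bound free of suprema; [bnorm_le] and [bidual_le_bnorm] relate it to [bnorm]. *)
Definition bidual_le phi (c : R) := forall f, dual_ball f -> `|phi f| <= c.

Let dnorm_set f := [set `|sval f x| | x in [set x : X | `|x| <= 1]].

Let dnorm_has_sup f : has_sup (dnorm_set f).
Proof.
have [C C0 fC] := dual_bounded f; split.
  by exists `|sval f 0|, 0 => //=; rewrite normr0.
exists C => _ [x /= x1 <-]; apply: le_trans (fC x) _.
by rewrite -[leRHS]mulr1 ler_wpM2l// ltW.
Qed.

Lemma dnorm_ge f x : `|x| <= 1 -> `|sval f x| <= dnorm f.
Proof. by move=> x1; apply: ub_le_sup; [exact: (dnorm_has_sup f).2|exists x]. Qed.

Lemma dnorm_le f (c : R) : (forall x, `|x| <= 1 -> `|sval f x| <= c) -> dnorm f <= c.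
Proof.
move=> fc; apply: ge_sup; first exact: (dnorm_has_sup f).1.
by move=> _ [x x1 <-]; exact: fc.
Qed.

Lemma dnorm_ge0 f : 0 <= dnorm f.
Proof. by apply: le_trans (@dnorm_ge f 0 _) => //; rewrite normr0. Qed.

Lemma dual_le_dnorm f x : `|sval f x| <= dnorm f * `|x|.
Proof.
have [->|x0] := eqVneq x 0; first by rewrite dual0 !normr0 mulr0.
have nx : 0 < `|x| by rewrite normr_gt0.
rewrite -ler_pdivrMr//.
have -> : `|sval f x| / `|x| = `|sval f (`|x|^-1 *: x)|.
  by rewrite dualZ normrM mulrC gtr0_norm// invr_gt0.
by apply: dnorm_ge; rewrite normrZ gtr0_norm ?invr_gt0// mulVf// gt_eqF.
Qed.

Lemma dnorm_le1 f : dnorm f <= 1 <-> dual_ball f.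
Proof.
split=> [f1 x|f1].
  by apply: le_trans (dual_le_dnorm f x) _; rewrite -[leRHS]mul1r ler_wpM2r.
by apply: dnorm_le => x x1; exact: le_trans (f1 x) x1.
Qed.

Lemma dual_ball_comb_closed : comb_closed dual_comb dual_ball.
Proof.
move=> a b f g Bf Bg ab x /=; rewrite (le_trans (ler_normD _ _))// !normrM.
apply: (@le_trans _ _ ((`|a| + `|b|) * `|x|)); last first.
  by rewrite -[leRHS]mul1r ler_wpM2r.
by rewrite mulrDl lerD// ler_wpM2l.
Qed.

Lemma dual_scale_ball f : exists2 c : R, 0 < c & exists2 g,
  dual_ball g & forall x, sval f x = c * sval g x.
Proof.
have [C C0 fC] := dual_bounded f; exists C => //.
exists (dual_comb C^-1 0 f f) => x /=; rewrite mul0r addr0.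
  by rewrite normrM gtr0_norm ?invr_gt0// ler_pdivrMl.
by rewrite mulVKf// gt_eqF.
Qed.

Lemma bidual_comb phi (a b : R) f g : is_bidual phi ->
  phi (dual_comb a b f g) = a * phi f + b * phi g.
Proof.
move=> [pl _]; pose o := dual_comb 0 0 f f.
have o0 x : sval o x = 0 by rewrite /= !mul0r addr0.
have p0 : phi o = 0.
  have /(pl 1) : forall x, sval o x = 1 * sval o x + sval o x by move=> x; rewrite o0; lra.
  lra.
rewrite (pl a f (dual_comb 0 b f g) (dual_comb a b f g)); last by move=> x /=; lra.
by rewrite (pl b g o (dual_comb 0 b f g)) ?p0 ?addr0// => x /=; lra.
Qed.

Lemma bidualZ phi (a : R) f g : is_bidual phi ->
  (forall x, sval f x = a * sval g x) -> phi f = a * phi g.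
Proof.
move=> bp fg; have -> : f = dual_comb a 0 g g by apply: dual_eq => x /=; rewrite fg; lra.
by rewrite bidual_comb//; lra.
Qed.

Lemma bidual_linear_on phi K : is_bidual phi -> linear_on dual_comb K phi.
Proof. by move=> bp a b f g _ _ _; exact: bidual_comb. Qed.

Lemma bidual_eq_ball phi psi : is_bidual phi -> is_bidual psi ->
  (forall f, dual_ball f -> phi f = psi f) -> phi = psi.
Proof.
move=> bp bq pq; apply/funext => f; have [c c0 [g Bg fg]] := dual_scale_ball f.
by rewrite (bidualZ bp fg) (bidualZ bq fg) pq.
Qed.

Lemma bidual_bounded phi : is_bidual phi -> exists2 c : R, 0 < c & bidual_le phi c.
Proof.
move=> [_ [C pC]]; exists (`|C| + 1) => [|f /dnorm_le1 f1]; first by rewrite ltr_wpDl.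
apply: le_trans (pC f) _; have := ler_norm C; have := dnorm_ge0 f.
have := normr_ge0 C; nra.
Qed.

Lemma bidual_le_dnorm phi (c : R) f : is_bidual phi -> bidual_le phi c ->
  `|phi f| <= c * dnorm f.
Proof.
(* When [dnorm f = 0] normalisation is impossible, but the bound inside [is_bidual] forces
   [phi f = 0]. *)
move=> bp pc; have [d0|d0] := eqVneq (dnorm f) 0.
  have [_ [C pC]] := bp; have := pC f; rewrite d0 !mulr0; exact.
have dp : 0 < dnorm f by rewrite lt_neqAle eq_sym d0 dnorm_ge0.
pose g := dual_comb (dnorm f)^-1 0 f f.
have Bg : dual_ball g.
  move=> x /=; rewrite mul0r addr0 normrM gtr0_norm ?invr_gt0//.
  by rewrite ler_pdivrMl//; exact: dual_le_dnorm.
have -> : phi f = dnorm f * phi g.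
  by apply: bidualZ => // x /=; rewrite mul0r addr0 mulVKf.
by rewrite normrM gtr0_norm// mulrC ler_wpM2r ?pc ?dnorm_ge0.
Qed.

Lemma bidual_intro phi (c : R) :
  (forall (a b : R) f g, phi (dual_comb a b f g) = a * phi f + b * phi g) ->
  bidual_le phi c -> is_bidual phi.
Proof.
move=> pl pc; split=> [a f g h hfg|].
  have -> : h = dual_comb a 1 f g by apply: dual_eq => x /=; rewrite hfg; lra.
  by rewrite pl mul1r.
exists c => f; have [d0|d0] := eqVneq (dnorm f) 0.
  have -> : f = dual_comb 0 0 f f.
    apply: dual_eq => x /=; rewrite !mul0r addr0; apply/eqP; rewrite -normr_le0.
    by apply: le_trans (dual_le_dnorm f x) _; rewrite d0 mul0r.
  rewrite pl !mul0r addr0 normr0 mulr_ge0 ?dnorm_ge0//.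
  apply: le_trans (normr_ge0 (phi (dual_comb 0 0 f f))) _; apply: pc => x /=.
  by rewrite !mul0r addr0 normr0.
have dp : 0 < dnorm f by rewrite lt_neqAle eq_sym d0 dnorm_ge0.
pose g := dual_comb (dnorm f)^-1 0 f f.
have Bg : dual_ball g.
  move=> x /=; rewrite mul0r addr0 normrM gtr0_norm ?invr_gt0//.
  by rewrite ler_pdivrMl//; exact: dual_le_dnorm.
have -> : phi f = dnorm f * phi g by rewrite pl mul0r addr0 mulVKf.
by rewrite normrM gtr0_norm// mulrC ler_wpM2r ?pc ?dnorm_ge0.
Qed.

Let bnorm_has_sup phi c : bidual_le phi c ->
  has_sup [set `|phi f| | f in [set f : dualT X | dnorm f <= 1]].
Proof.
move=> pc; have o : is_dual (fun _ : X => (0 : R)).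
  by apply: (@bounded_is_dual _ 0) => [a x y|x]; rewrite ?normr0 ?mulr0 ?addr0 ?mul0r.
split.
  exists `|phi (mk_dual o)|, (mk_dual o) => //=.
  by apply/dnorm_le1 => x /=; rewrite normr0.
by exists c => _ [f /= /dnorm_le1 Bf <-]; exact: pc.
Qed.

Lemma bnorm_le phi (c : R) : bidual_le phi c -> bnorm phi <= c.
Proof.
move=> pc; apply: ge_sup; first exact: (bnorm_has_sup pc).1.
by move=> _ [f /= /dnorm_le1 Bf <-]; exact: pc.
Qed.

Lemma bidual_le_bnorm phi (c : R) : is_bidual phi -> bnorm phi <= c -> bidual_le phi c.
Proof.
move=> bp pc f Bf; have [d _ pd] := bidual_bounded bp; apply: le_trans pc.
by apply: ub_le_sup; [exact: (bnorm_has_sup pd).2|exists f => //; exact/dnorm_le1].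
Qed.

Definition embed x : dualT X -> R := fun f => sval f x.

Lemma embed_le x : bidual_le (embed x) `|x|.
Proof. by move=> f; apply. Qed.

Lemma is_bidual_embed x : is_bidual (embed x).
Proof. by apply: bidual_intro (@embed_le x). Qed.

Lemma is_bidual_comb (a b : R) phi psi : is_bidual phi -> is_bidual psi ->
  is_bidual (fun f => a * phi f + b * psi f).
Proof.
move=> bp bq; have [c c0 pc] := bidual_bounded bp; have [d d0 qd] := bidual_bounded bq.
apply: (@bidual_intro _ (`|a| * c + `|b| * d)) => [a' b' f g|f Bf].
  by rewrite !bidual_comb//; ring.
rewrite (le_trans (ler_normD _ _))// !normrM.
by apply: lerD; apply: ler_wpM2l => //; [exact: pc|exact: qd].
Qed.

(** Hahn-Banach with the norm as sublinear majorant. The case [x = 0] also serves to produce some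
    element of the dual ball. *)
Lemma norming_functional x : exists2 f, dual_ball f & sval f x = `|x|.
Proof.
have sn : sublinear (fun y : X => `|y|).
  split=> [y z|a y a0]; first exact: ler_normD.
  by rewrite normrZ ger0_norm.
have [f [fl fn fx]] := hahn_banach x sn.
have fN y : f (- y) = - f y.
  have f0 : f 0 = 0 by have := fl 1 0 0; rewrite scale1r addr0; lra.
  by have := fl (-1) y 0; rewrite scaleN1r !addr0 f0; lra.
have fb y : `|f y| <= 1 * `|y|.
  rewrite mul1r ler_norml fn andbT lerNl -fN.
  by apply: le_trans (fn _) _; rewrite normrN.
exists (mk_dual (bounded_is_dual fl fb)) => // y /=.
by rewrite -[leRHS]mul1r.
Qed.

Lemma embed_leE x (c : R) : bidual_le (embed x) c -> `|x| <= c.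
Proof.
move=> xc; have [f Bf fx] := norming_functional x.
by have := xc _ Bf; rewrite /embed fx normr_id.
Qed.

(** Banach-Alaoglu along an ultrafilter: bounded scalars converge at each [x], and linearity and the
    bound [|x|] pass to the limit. *)
Lemma dual_ultra_cvg (T : Type) (U : set_system T) (f : T -> dualT X) :
  UltraFilter U -> (forall t, dual_ball (f t)) ->
  exists2 g, dual_ball g & forall x, (fun t => sval (f t) x) @ U --> sval g x.
Proof.
move=> UU Bf.
have /choice[g fg] x : exists l : R, (fun t => sval (f t) x) @ U --> l.
  by apply: (@ultra_bounded_cvg _ _ _ _ `|x|) => t; exact: Bf.
have gl (a : R) x y : g (a *: x + y) = a * g x + g y.
  apply: (@cvg_unique _ _ _ _ _ _ (fg (a *: x + y))) => //.
  rewrite (_ : (fun t => _) = (fun t => a * sval (f t) x + sval (f t) y)).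
    by apply: (cvgD _ (fg y)); exact: cvgMl_tmp.
  by apply/funext => t; rewrite dualP.
have gB x : `|g x| <= 1 * `|x|.
  rewrite mul1r; apply: (cvgr_to_le (cvg_norm (fg x))).
  by apply: nearW => t; exact: Bf.
exists (mk_dual (bounded_is_dual gl gB)) => // x.
by rewrite /= -[leRHS]mul1r.
Qed.

End Dual.

(** * Separable subspaces *)

(** Recursion in which each term may depend on all earlier ones: a choice function on histories is
    iterated. *)
Lemma strong_choice (T : Type) (Q : seq T -> T -> Prop) :
  (forall h, exists t, Q h t) -> exists u : nat -> T, forall n, Q (mkseq u n) (u n).
Proof.
move=> /choice[G QG]; pose hist n := iter n (fun h => rcons h (G h)) [::].
exists (G \o hist) => n; suff -> : mkseq (G \o hist) n = hist n by exact: QG.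
by elim: n => // n IH; rewrite mkseqS IH.
Qed.

Lemma ratr_approx (R : realType) (a e : R) : 0 < e -> exists s : rat, `|a - ratr s| < e.
Proof.
move=> e0; have ae : a - e < a + e by lra.
have [s] := rat_in_itvoo ae; rewrite in_itv /= => /andP[s1 s2].
by exists s; rewrite ltr_norml; apply/andP; split; lra.
Qed.

Lemma exists_invS_lt (R : realType) (e : R) : 0 < e -> exists n, n.+1%:R^-1 < e.
Proof.
move=> e0; have [n _ hn] := near_infty_natSinv_lt (PosNum e0).
by exists n; exact: hn n (leqnn n).
Qed.

Section RationalSpan.
Variables (R : realType) (X : normedModType R) (a : nat -> X).
Implicit Types (x y : X) (q : seq (rat * nat)).

(** Rational coefficients leave countably many combinations, which [countable_separation]
    enumerates. *)
Definition rat_comb q : X := \sum_(p <- q) (ratr p.1 : R) *: a p.2.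

Definition closed_span : set X :=
  [set x | forall e : R, 0 < e -> exists q, `|x - rat_comb q| <= e].

Lemma closed_span0 : closed_span 0.
Proof. by move=> e e0; exists [::]; rewrite /rat_comb big_nil subr0 normr0 ltW. Qed.

Lemma closed_span_seq n : closed_span (a n).
Proof.
move=> e e0; exists [:: (1, n)].
by rewrite /rat_comb big_seq1 /= rmorph1 scale1r subrr normr0 ltW.
Qed.

Lemma closed_span_lin (c : R) x y :
  closed_span x -> closed_span y -> closed_span (c *: x + y).
Proof.
move=> Px Py e e0.
have c1 : 0 < `|c| + 1 by rewrite ltr_wpDl.
(* The three errors [c *: (x - u)], [(c - s) *: u] and [y - v], with [u] and [v] standing for their
   combinations, get [e / 3] each; adding [1] keeps the denominators positive. *)
have [|u xu] := Px (e / 3 / (`|c| + 1)); first by rewrite divr_gt0//; lra.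
have u1 : 0 < `|rat_comb u| + 1 by rewrite ltr_wpDl.
have [|s cs] := @ratr_approx _ c (e / 3 / (`|rat_comb u| + 1)).
  by rewrite divr_gt0//; lra.
have [|v yv] := Py (e / 3); first lra.
exists ([seq (s * p.1, p.2) | p <- u] ++ v).
have -> : rat_comb ([seq (s * p.1, p.2) | p <- u] ++ v) =
    ratr s *: rat_comb u + rat_comb v.
  rewrite /rat_comb big_cat big_map /= scaler_sumr; congr (_ + _).
  by apply: eq_bigr => p _; rewrite rmorphM scalerA.
have -> : c *: x + y - (ratr s *: rat_comb u + rat_comb v) =
    c *: (x - rat_comb u) + (c - ratr s) *: rat_comb u + (y - rat_comb v).
  by rewrite scalerBr scalerBl subrKA opprD addrACA.
rewrite (le_trans (ler_normD _ _))//; have := ler_normD (c *: (x - rat_comb u)) ((c - ratr s) *: rat_comb u).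
rewrite !normrZ.
move: xu cs; rewrite ler_pdivlMr// ltr_pdivlMr// => xu cs.
have := normr_ge0 (x - rat_comb u); have := normr_ge0 (c - ratr s); nra.
Qed.

End RationalSpan.

Section Separation.
Variables (R : realType) (X : normedModType R).
Implicit Types (f g : dualT X) (phi psi y : dualT X -> R) (x : X).

(** Otherwise [y] is at most [d] on the part of the dual ball that kills [a i] for [i < n], and
    [approx_lagrange] puts [y] within [d] of a point of [P]. *)
Lemma annihilating_functional y (P : set X) (d : R) (a : nat -> X) n :
  is_bidual y -> P 0 -> (forall (c : R) u v, P u -> P v -> P (c *: u + v)) ->
  (forall i, P (a i)) ->
  (forall z, P z -> ~ bidual_le (fun f => y f - embed z f) d) ->
  exists2 f, dual_ball f & (forall i, (i < n)%N -> sval f (a i) = 0) /\ d <= y f.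
Proof.
move=> by_ P0 PD Pa yd; apply: contrapT => nof.
have small f : dual_ball f -> (forall i, (i < n)%N -> sval f (a i) = 0) -> y f <= d.
  move=> Bf fa; apply/ltW; rewrite ltNge; apply/negP => dyf; apply: nof.
  by exists f.
have [|||||||z Pz hz] := @approx_lagrange _ _ (@dual_comb R X) X
    (fun x f => sval f x) P a d n (@dual_ball R X) y.
- by exists 0 => // f _; rewrite dual0.
- by move=> c u v Pu Pv; exists (c *: u + v); [exact: PD|move=> f _; exact: dualP].
- by [].
- by move=> i _; exact: Pa.
- exact: dual_ball_comb_closed.
- exact: bidual_linear_on.
- move=> f Bf fa; apply/ler_normlP; split; last exact: small.
  (* The lower bound is the upper bound at [- f]. *)
  have -> : - y f = y (dual_comb (-1) 0 f f) by rewrite bidual_comb//; lra.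
  apply: small => [|i i_n]; last by rewrite /= fa//; lra.
  by move=> x /=; rewrite mul0r addr0 mulN1r normrN.
- exact: yd Pz hz.
Qed.

(** A point outside is farther than [e / 2] from the closed span for some [e > 0]. Functionals
    killing the first [n] terms with value at least [e / 2] at [x] have an ultrafilter limit killing
    all terms. *)
Lemma closed_span_separation (a : nat -> X) x : ~ closed_span a x ->
  exists2 f, dual_ball f & (forall i, sval f (a i) = 0) /\ 0 < sval f x.
Proof.
move=> /existsNP[e /not_implyP[e0 /forallNP xe]].
have e20 : 0 < e / 2 by lra.
have /choice[f hf] n : exists f, dual_ball f /\
    ((forall i, (i < n)%N -> sval f (a i) = 0) /\ e / 2 <= embed x f).
  have [|f Bf hf] := @annihilating_functional (embed x) (closed_span a) (e / 2) a n
    (is_bidual_embed x) (closed_span0 a) (@closed_span_lin _ _ a) (closed_span_seq a); last by exists f.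
  move=> z Pz zx; have [q zq] := Pz _ e20; apply: (xe q).
  have : `|x - z| <= e / 2 by apply: embed_leE => f Bf; rewrite /embed dualB; exact: zx.
  by move=> xz; rewrite -(subrKA z) (le_trans (ler_normD _ _))//; lra.
have [U UU Uinf] := ultra_eventually.
have [g Bg fg] := dual_ultra_cvg UU (fun n => (hf n).1).
exists g => //; split=> [i|].
  apply: (@cvg_unique _ _ _ _ _ _ (fg (a i))) => //.
  apply: (@cvg_near_cst _ _ _ _ U).
  by apply: filterS (Uinf i.+1) => n /= i_n; rewrite (hf n).2.1.
apply: lt_le_trans e20 _; apply: (cvgr_to_ge (fg x)).
by apply: nearW => n; exact: (hf n).2.2.
Qed.

(** The supremum over the ball need not be attained; the factor [2] admits a near-maximiser. *)
Lemma half_norming_functional psi : is_bidual psi ->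
  exists2 g, dual_ball g & forall f, dual_ball f -> `|psi f| <= 2 * `|psi g|.
Proof.
move=> bp; have [g0 Bg0 _] := norming_functional (0 : X).
have [c _ pc] := bidual_bounded bp.
pose S := [set `|psi f| | f in @dual_ball R X].
have Ssup : has_sup S.
  by split; [exists `|psi g0|, g0|exists c => _ [f Bf <-]; exact: pc].
have Sge f : dual_ball f -> `|psi f| <= sup S.
  by move=> Bf; apply: ub_le_sup; [exact: Ssup.2|exists f].
have [S0|S0] := leP (sup S) 0.
  exists g0 => // f Bf; apply: le_trans (Sge f Bf) _; apply: le_trans S0 _.
  by rewrite mulr_ge0.
have S20 : 0 < sup S / 2 by lra.
have [_ [g Bg <-] hg] := sup_adherent S20 Ssup.
by exists g => // f Bf; have := Sge f Bf; lra.
Qed.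

(** Half-norming functionals are chosen for the countably many rational combinations of the [a n]
    and [z]. These combinations are norm dense among the [w], so a [w] vanishing at all chosen
    functionals is arbitrarily small on the ball. *)
Lemma countable_separation (a : nat -> X) (z : dualT X -> R) : is_bidual z ->
  exists d : nat -> dualT X, forall x (r : R), closed_span a x ->
    let w := fun f => 1 * embed x f + r * z f in
    (forall i, w (d i) = 0) -> forall f, w f = 0.
Proof.
move=> bz; have [g0 Bg0 _] := norming_functional (0 : X).
pose u (q : rat * seq (rat * nat)) := fun f =>
  1 * embed (rat_comb a q.2) f + ratr q.1 * z f.
have bu q : is_bidual (u q) by apply: is_bidual_comb => //; exact: is_bidual_embed.
have /choice[g gu] q : exists g, dual_ball g /\
    forall f, dual_ball f -> `|u q f| <= 2 * `|u q g|.
  by have [g Bg hg] := half_norming_functional (bu q); exists g.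
(* Indices that code no combination receive the default [g0]. *)
exists (fun i => if unpickle i is Some q then g q else g0) => x r Px w w0.
have bw : is_bidual w by apply: is_bidual_comb => //; exact: is_bidual_embed.
suff w_ball f : dual_ball f -> w f = 0.
  move=> f; have [c c0 [h Bh fh]] := dual_scale_ball f.
  by rewrite (bidualZ bw fh) w_ball// mulr0.
move=> Bf; apply/eqP; rewrite -normr_le0; apply/ler_addgt0Pr => e e0; rewrite add0r.
have [C C0 zC] := bidual_bounded bz.
(* Two errors of [e / 6] make [u] differ from [w] by at most [e / 3] on the ball. Then [u] is at
   most [e / 3] at its half-norming functional, so at most [2 e / 3] on the ball, and [w] at most
   [e]. *)
have [|q xq] := Px (e / 6); first lra.
have [|s rs] := @ratr_approx _ r (e / 6 / C); first by rewrite divr_gt0//; lra.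
have near_u h : dual_ball h -> `|w h - u (s, q) h| <= e / 3.
  move=> Bh; have -> : w h - u (s, q) h =
      sval h (x - rat_comb a q) + (r - ratr s) * z h.
    by rewrite /w /u /embed dualB; ring.
  rewrite (le_trans (ler_normD _ _))// normrM.
  have := Bh (x - rat_comb a q); have := zC _ Bh.
  move: rs; rewrite ltr_pdivlMr// => rs.
  have := normr_ge0 (r - ratr s); have := normr_ge0 (z h); nra.
have := near_u _ (gu (s, q)).1; have := w0 (pickle (s, q)); rewrite pickleK => ->.
rewrite sub0r normrN => ug.
have := (gu (s, q)).2 _ Bf; have := near_u _ Bf => h1 h2.
rewrite -[w f](subrK (u (s, q) f)) (le_trans (ler_normD _ _))//; lra.
Qed.

End Separation.

(** * The subspace spanned by X and one bidual element *)

Lemma invS_le (R : realType) (N n : nat) : (N <= n)%N -> (n.+1%:R : R)^-1 <= N.+1%:R^-1.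
Proof. by move=> Nn; rewrite lef_pV2 ?posrE// ler_nat. Qed.

Section SpanEmbed.
Variables (R : realType) (X : completeNormedModType R).
Implicit Types (f : dualT X) (phi psi : dualT X -> R) (x : X).

(** The embedding is isometric, so approximants with error [1 / (n + 1)] form a Cauchy sequence,
    which converges by completeness of [X]. *)
Lemma embed_closed phi : is_bidual phi ->
  (forall e : R, 0 < e -> exists x, bidual_le (fun f => phi f - embed x f) e) ->
  exists x, phi = embed x.
Proof.
move=> bp pe.
have /choice[x hx] n : exists x, bidual_le (fun f => phi f - embed x f) n.+1%:R^-1.
  by apply: pe; rewrite invr_gt0.
have xx n m : `|x n - x m| <= n.+1%:R^-1 + m.+1%:R^-1.
  apply: embed_leE => f Bf; have := hx n f Bf; have := hx m f Bf.
  rewrite /embed dualB => h1 h2.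
  rewrite -(subrKA (phi f)) (le_trans (ler_normD _ _))// distrC lerD//.
have : cvg (x @ \oo).
  apply: cauchy_cvg; apply/cauchy_exP => e e0.
  have [N hN] := @exists_invS_lt R (e / 2) ltac:(lra).
  exists (x N); exists N => // n /= Nn; rewrite -ball_normE /=.
  apply: le_lt_trans (xx N n) _.
  rewrite [ltRHS]splitr; apply: ltrD => //; apply: le_lt_trans hN.
  exact: invS_le.
move=> /cvg_ex[l xl]; exists l.
apply: (bidual_eq_ball bp (is_bidual_embed l)) => f Bf.
apply/eqP; rewrite -subr_eq0 -normr_le0; apply/ler_addgt0Pr => e e0; rewrite add0r.
have e20 : 0 < e / 2 by lra.
have [N hN] := exists_invS_lt e20.
have [n [Nn nl]] : exists n, (N <= n)%N /\ `|l - x n| < e / 2.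
  have /filter_ex[n [h1 h2]] : \forall n \near \oo, `|l - x n| < e / 2 /\ (N <= n)%N.
    by apply: filterI; [by move/cvgrPdist_lt: xl; exact|exact: nbhs_infty_ge].
  by exists n.
rewrite -(subrKA (sval f (x n))) (le_trans (ler_normD _ _))//.
rewrite [leRHS]splitr; apply: lerD; apply: ltW.
  exact: le_lt_trans (hx n f Bf) (le_lt_trans (invS_le R Nn) hN).
by rewrite distrC -dualB; exact: le_lt_trans (Bf _) nl.
Qed.

Definition span_embed phi : set (dualT X -> R) :=
  [set psi | exists x (t : R), psi = (fun f => 1 * embed x f + t * phi f)].

Lemma is_bidual_span phi psi : is_bidual phi -> span_embed phi psi -> is_bidual psi.
Proof.
by move=> bp [x [t ->]]; apply: is_bidual_comb => //; exact: is_bidual_embed.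
Qed.

Lemma embed_in_span phi x : span_embed phi (embed x).
Proof. by exists x, 0; apply/funext => f; rewrite mul1r mul0r addr0. Qed.

Lemma self_in_span phi : span_embed phi phi.
Proof.
by exists 0, 1; apply/funext => f; rewrite /embed dual0 mulr0 add0r mul1r.
Qed.

Lemma span_embed_comb phi (a b : R) psi1 psi2 :
  span_embed phi psi1 -> span_embed phi psi2 ->
  span_embed phi (fun f => a * psi1 f + b * psi2 f).
Proof.
move=> [x1 [t1 ->]] [x2 [t2 ->]]; exists (a *: x1 + b *: x2), (a * t1 + b * t2).
by apply/funext => f; rewrite /embed dualP dualZ; ring.
Qed.

Lemma span_embed_subspace phi : is_bidual phi -> bidual_subspace (span_embed phi).
Proof.
move=> bp; split; first by move=> psi; exact: is_bidual_span.
split=> [|a psi1 psi2 h1 h2].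
  by exists 0, 0; apply/funext => f; rewrite /embed dual0; lra.
have := span_embed_comb a 1 h1 h2; congr span_embed.
by apply/funext => f; rewrite mul1r.
Qed.

(** The unit ball of [X] lies in the span and already computes [dnorm], so both constants are
    [1]. *)
Lemma span_embed_norming phi : is_bidual phi -> norming (span_embed phi).
Proof.
move=> bp; exists 1, 1; split=> //; split=> // z; rewrite !mul1r.
set S := [set _ | _ in _].
have Sub : ubound S (dnorm z).
  move=> _ [psi [Ypsi psi1] <-]; have bpsi := is_bidual_span bp Ypsi.
  apply: le_trans (ler_norm _) _; rewrite -[leRHS]mul1r.
  by apply: bidual_le_dnorm => //; exact: bidual_le_bnorm.
have Sx x : `|x| <= 1 -> S (sval z x).
  move=> x1; exists (embed x) => //; split; first exact: embed_in_span.
  by apply: bnorm_le => f Bf; apply: le_trans x1; exact: embed_le.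
split; last by apply: ge_sup => //; exists (sval z 0); apply: Sx; rewrite normr0.
have Sle r : S r -> r <= sup S by move=> Sr; apply: ub_le_sup => //; exists (dnorm z).
apply: dnorm_le => x x1; apply/ler_normlP; split; last exact: Sle (Sx _ x1).
by rewrite -mulN1r -dualZ; apply/Sle/Sx; rewrite normrZ normrN1 mul1r.
Qed.

Lemma embed_distance phi : is_bidual phi -> (forall x, phi <> embed x) ->
  exists2 d : R, 0 < d & forall x, ~ bidual_le (fun f => phi f - embed x f) d.
Proof.
move=> bp pX; apply: contrapT => h; have [x] : exists x, phi = embed x; last exact: pX.
apply: embed_closed => // e e0; apply: contrapT => /forallNP he.
by apply: h; exists e.
Qed.

(** Division by [t] turns the bound [c] into a bound [c / |t|] on the distance from [phi] to
    [- t^-1 *: x]. Hence the [phi]-coefficient is norm bounded on the span. *)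
Lemma span_coef_bound phi (d : R) x (t c : R) : 0 < d ->
  (forall x, ~ bidual_le (fun f => phi f - embed x f) d) ->
  bidual_le (fun f => 1 * embed x f + t * phi f) c -> `|t| * d <= c.
Proof.
move=> d0 pd xc; rewrite leNgt; apply/negP => ct.
have [g Bg _] := norming_functional (0 : X).
have c0 : 0 <= c by apply: le_trans (xc g Bg).
have t0 : 0 < `|t| by nra.
have tn : t != 0 by rewrite -normr_gt0.
apply: (pd (- t^-1 *: x)) => f Bf.
have -> : phi f - embed (- t^-1 *: x) f = t^-1 * (1 * embed x f + t * phi f).
  by rewrite /embed dualZ; field.
rewrite normrM normfV ler_pdivrMl//; apply: le_trans (xc f Bf) _; exact: ltW.
Qed.

Lemma span_coef_unique phi x1 x2 (t1 t2 : R) : is_bidual phi ->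
  (forall x, phi <> embed x) ->
  (forall f, 1 * embed x1 f + t1 * phi f = 1 * embed x2 f + t2 * phi f) -> t1 = t2.
Proof.
move=> bp pX h; have [d d0 pd] := embed_distance bp pX.
have : `|t1 - t2| * d <= 0.
  apply: (@span_coef_bound phi d (x1 - x2)) => // f _.
  by have := h f; rewrite /embed dualB => hf; rewrite normr_le0; apply/eqP; lra.
by rewrite pmulr_lle0// normr_le0 subr_eq0 => /eqP.
Qed.

(** Approximants of [psi] have bounded [phi]-coefficients; with [t] a limit of these, [psi - t phi]
    is a norm limit of elements of [X], hence in [X]. *)
Lemma span_embed_closed phi : is_bidual phi -> (forall x, phi <> embed x) ->
  norm_closed (span_embed phi).
Proof.
move=> bp pX psi bpsi hpsi; have [d d0 pd] := embed_distance bp pX.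
have /choice[xt hxt] n : exists xt : X * R,
    bidual_le (fun f => psi f - (1 * embed xt.1 f + xt.2 * phi f)) n.+1%:R^-1.
  have n0 : 0 < (n.+1%:R : R)^-1 by rewrite invr_gt0.
  have [chi Ychi psichi] := hpsi _ n0; have bchi := is_bidual_span bp Ychi.
  have bd : is_bidual (fun f => psi f - chi f).
    rewrite (_ : (fun f => _) = (fun f => 1 * psi f + (-1) * chi f)).
      exact: is_bidual_comb.
    by apply/funext => h; lra.
  case: Ychi => x [t chiE]; exists (x, t) => f Bf /=.
  by have := bidual_le_bnorm bd psichi Bf; rewrite chiE.
have [C C0 psiC] := bidual_bounded bpsi; have [D D0 phiD] := bidual_bounded bp.
(* Approximants have norm at most [C + 1]: [psi] contributes [C] and the error at most [1]. *)
have tb n : `|(xt n).2| <= (C + 1) / d.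
  rewrite ler_pdivlMr//; apply: (@span_coef_bound phi d (xt n).1) => // f Bf.
  have := hxt n f Bf; have := psiC f Bf.
  have : (n.+1%:R : R)^-1 <= 1 by rewrite invf_le1 ?ler1n.
  move=> h1 h2 h3; rewrite -[X in `|X|](subKr (psi f)) (le_trans (ler_normB _ _))//.
  exact: lerD h2 (le_trans h3 h1).
have [U UU Uinf] := ultra_eventually.
have [t ht] := ultra_bounded_cvg UU tb.
have bpt := is_bidual_comb 1 (- t) bpsi bp.
have [|x hx] := embed_closed bpt.
  move=> e e0.
  have e20 : 0 < e / 2 by lra.
  have [N hN] := exists_invS_lt e20.
  have e2D : 0 < e / 2 / D by rewrite divr_gt0.
  have /filter_ex[n [h1 h2]] : U [set n | `|t - (xt n).2| < e / 2 / D /\ (N <= n)%N].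
    by apply: filterI; [by move/cvgrPdist_lt: ht; exact|exact: Uinf].
  exists (xt n).1 => f Bf.
  have h4 := invS_le R h2.
  have -> : 1 * psi f + - t * phi f - embed (xt n).1 f =
    (psi f - (1 * embed (xt n).1 f + (xt n).2 * phi f)) - (t - (xt n).2) * phi f by ring.
  rewrite (le_trans (ler_normB _ _))// normrM.
  have := hxt n f Bf; have := phiD f Bf; move: h1; rewrite ltr_pdivlMr//.
  move=> h1D pf h3; rewrite [leRHS]splitr; apply: lerD.
    exact: le_trans h3 (le_trans h4 (ltW hN)).
  by apply: le_trans (ltW h1D); rewrite ler_wpM2l.
exists x, t; apply/funext => f; rewrite -hx; lra.
Qed.

End SpanEmbed.

(** * Weak* cluster points of sequences *)

Section ClusterSequence.
Variables (R : realType) (X : completeNormedModType R).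
Implicit Types (f : dualT X) (phi psi y : dualT X -> R) (x : X).

(** Compactness tested on sequences along ultrafilters; in this form it passes to sums of sets
    termwise. *)
Definition ultra_compact (K : set (dualT X -> R)) :=
  forall (U : set_system nat) (y : nat -> dualT X -> R), UltraFilter U ->
    (forall n, K (y n)) ->
    exists2 z, K z & forall f, (fun n => y n f) @ U --> z f.

(* Each [f n] kills the earlier [a i] while [f i (a n) = y (f i) >= d] for later [a n], so
   the iterated limits of [f i (a n)] differ and no cluster point of [a] lies in [X]. *)
Lemma double_sequence y (d : R) (g0 : dualT X) (K : set (dualT X -> R)) :
  is_bidual y -> (forall x, ~ bidual_le (fun f => y f - embed x f) d) ->
  (forall s : seq (dualT X), exists2 x, K (embed x) &
    forall i, (i < size s)%N -> sval (nth g0 s i) x = y (nth g0 s i)) ->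
  exists (a : nat -> X) (f : nat -> dualT X),
    [/\ forall n, K (embed (a n)), forall n, dual_ball (f n),
      forall n, d <= y (f n),
      forall i n, (i < n)%N -> sval (f n) (a i) = 0 &
      forall i n, (i <= n)%N -> sval (f i) (a n) = y (f i)].
Proof.
move=> by_ yd agree.
pose t0 : X * dualT X := (0, g0).
pose Q (h : seq (X * dualT X)) (t : X * dualT X) :=
  [/\ K (embed t.1), dual_ball t.2, d <= y t.2,
    forall i, (i < size h)%N -> sval t.2 (nth t0 h i).1 = 0 &
    forall i, (i < size h)%N -> sval (nth t0 h i).2 t.1 = y (nth t0 h i).2] /\
  sval t.2 t.1 = y t.2.
have [h|u Qu] := @strong_choice _ Q.
  have [|f Bf [fa df]] := @annihilating_functional _ _ y setT d
      (fun i => (nth t0 h i).1) (size h) by_ I (fun _ _ _ _ _ => I) (fun _ => I).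
    by move=> z _; exact: yd.
  (* Appending the new [f] before choosing [x] secures the diagonal equality [f x = y f] as well. *)
  have [x Kx xs] := agree (rcons [seq t.2 | t <- h] f).
  rewrite size_rcons size_map in xs.
  exists (x, f); split; [split=> //= i ih|].
    have := xs i (ltnW ih); rewrite nth_rcons size_map ih (nth_map t0)//.
  by have := xs (size h) (ltnSn _); rewrite nth_rcons size_map ltnn eqxx.
exists (fun n => (u n).1), (fun n => (u n).2); split=> [n|n|n|i n i_n|i n].
- by have [[]] := Qu n.
- by have [[]] := Qu n.
- by have [[]] := Qu n.
- have [[_ _ _ h _] _] := Qu n; have := h i; rewrite size_mkseq nth_mkseq//; exact.
- rewrite leq_eqVlt => /predU1P[->|i_n]; first by have [_] := Qu n.
  have [[_ _ _ _ h] _] := Qu n; have := h i; rewrite size_mkseq nth_mkseq//; exact.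
Qed.

(** A limit [g] of the [f n] kills every [a i], so [z g = 0]; but [z (f i) = y (f i) >= d], and
    [z = embed x] would give [g x >= d] in the limit. *)
Lemma limit_not_embed y (d : R) (a : nat -> X) (f : nat -> dualT X)
    (U : set_system nat) (z : dualT X -> R) : 0 < d ->
  UltraFilter U -> (forall n, U [set m | (n <= m)%N]) ->
  (forall n, dual_ball (f n)) -> (forall n, d <= y (f n)) ->
  (forall i n, (i < n)%N -> sval (f n) (a i) = 0) ->
  (forall i n, (i <= n)%N -> sval (f i) (a n) = y (f i)) ->
  (forall g, (fun n => embed (a n) g) @ U --> z g) ->
  forall x, z <> embed x.
Proof.
move=> d0 UU Uinf Bf dy fa fy az x zx.
have zf i : z (f i) = y (f i).
  apply: (@cvg_unique _ _ _ _ _ _ (az (f i))) => //.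
  apply: (@cvg_near_cst _ _ _ _ U).
  by apply: filterS (Uinf i) => n /= i_n; rewrite /embed fy.
have [g Bg fg] := dual_ultra_cvg UU Bf.
have ga i : sval g (a i) = 0.
  apply: (@cvg_unique _ _ _ _ _ _ (fg (a i))) => //.
  apply: (@cvg_near_cst _ _ _ _ U).
  by apply: filterS (Uinf i.+1) => n /= i_n; rewrite fa.
have zg : z g = 0.
  apply: (@cvg_unique _ _ _ _ _ _ (az g)) => //.
  apply: (@cvg_near_cst _ _ _ _ U).
  by apply: nearW => n; rewrite /embed ga.
have : d <= sval g x.
  apply: (cvgr_to_ge (fg x)); apply: nearW => n.
  by rewrite (le_trans (dy n))// -zf zx.
by rewrite -[sval g x]/(embed x g) -zx zg; lra.
Qed.

(** Finitely many conditions hold together on a set of [U]: [m j] is chosen within [1 / (j + 1)] at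
    [d 0], ..., [d j]. The indices need not increase. *)
Lemma diagonal_subsequence (U : set_system nat) (a : nat -> dualT X -> R)
    (z : dualT X -> R) (d : nat -> dualT X) : UltraFilter U ->
  (forall f, (fun n => a n f) @ U --> z f) ->
  exists m : nat -> nat, forall i, (fun j => a (m j) (d i)) @ \oo --> z (d i).
Proof.
move=> UU az.
have /choice[m mP] j : exists n, forall i, (i <= j)%N ->
    `|z (d i) - a n (d i)| < j.+1%:R^-1.
  suff /filter_ex[n hn] : U [set n | forall i, (i <= j)%N ->
    `|z (d i) - a n (d i)| < j.+1%:R^-1] by exists n.
  have near_i (i : nat) : U [set n | `|z (d i) - a n (d i)| < j.+1%:R^-1].
    by have /cvgrPdist_lt := az (d i); apply; rewrite invr_gt0.
  elim: {-2}j => [|k IH].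
    by apply: filterS (near_i 0) => n hn i; rewrite leqn0 => /eqP ->.
  apply: filterS (filterI IH (near_i k.+1)) => n [h1 h2] i.
  by rewrite leq_eqVlt => /predU1P[->//|]; exact: h1.
exists m => i; apply/cvgrPdist_lt => e e0.
have [N hN] := exists_invS_lt e0.
exists (maxn N i) => // j /=; rewrite geq_max => /andP[Nj ij].
by apply: lt_trans (mP j i ij) _; apply: le_lt_trans hN; exact: invS_le.
Qed.

(** A cluster point [z] outside [X] of the double sequence [a] is reached by [a \o m] on a countable
    set [D]. Every ultrafilter limit [w] of [a \o m] has the form [x + r z] with [x] in the closed
    span of [a], where agreement on [D] forces [w = z]. *)
Lemma cluster_sequence phi y (g0 : dualT X) (K : set (dualT X -> R)) :
  is_bidual phi -> K `<=` span_embed phi -> ultra_compact K ->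
  is_bidual y -> (forall x, y <> embed x) ->
  (forall s : seq (dualT X), exists2 x, K (embed x) &
    forall i, (i < size s)%N -> sval (nth g0 s i) x = y (nth g0 s i)) ->
  exists (b : nat -> X) (z : dualT X -> R), [/\ span_embed phi z,
    forall x, z <> embed x & forall f, (fun n => embed (b n) f) @ \oo --> z f].
Proof.
move=> bp KY Kc by_ yX agree; have [d d0 yd] := embed_distance by_ yX.
have [a [f [aK Bf dy fa fy]]] := double_sequence by_ yd agree.
have [U UU Uinf] := ultra_eventually.
have [z Kz az] := Kc U _ UU aK.
have zX := limit_not_embed d0 UU Uinf Bf dy fa fy az.
have bz := is_bidual_span bp (KY _ Kz).
have [D hD] := countable_separation a bz.
have [m mD] := diagonal_subsequence D UU az.
exists (a \o m), z; split=> //; first exact: KY.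
suff lim V : UltraFilter V -> \oo `<=` V ->
    forall g, (fun n => embed (a (m n)) g) @ V --> z g.
  by move=> g; apply: cvg_ultraP => V UV Vinf; exact: lim.
move=> UV Vinf; have [w Kw aw] := Kc V _ UV (fun n => aK (m n)).
suff -> : z = w by [].
have [xz [tz zE]] := KY _ Kz; have [xw [tw wE]] := KY _ Kw.
(* Since [z] is not in [X], it can replace [phi] as the second generator of the span, which
   expresses [w] through [z]. *)
have tz0 : tz != 0.
  apply/eqP => tz0; apply: (zX xz); rewrite zE tz0.
  by apply/funext => g; rewrite mul1r mul0r addr0.
pose r := tw / tz; pose x := xw - r *: xz.
have wzx g : w g = 1 * embed x g + r * z g.
  by rewrite zE wE /x /embed dualB dualZ /r; field.
(* A functional killing all [a i] kills their limits [w] and [z], hence [x], and cannot separate [x]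
   from the span. *)
have xspan : closed_span a x.
  apply: contrapT => /closed_span_separation[g Bg [ga gx]].
  have lim0 V' (v : dualT X -> R) (k : nat -> nat) : UltraFilter V' ->
      (fun n => embed (a (k n)) g) @ V' --> v g -> v g = 0.
    move=> UV' av; apply: (@cvg_unique _ _ _ _ _ _ av) => //.
    apply: (@cvg_near_cst _ _ _ _ V').
    by apply: nearW => n; rewrite /embed ga.
  have := wzx g; rewrite (lim0 _ _ _ UV (aw g)) (lim0 _ _ id UU (az g)) /embed; lra.
have wz0 i : 1 * embed x (D i) + (r - 1) * z (D i) = 0.
  have : w (D i) = z (D i).
    apply: (@cvg_unique _ _ _ _ _ _ (aw (D i))) => //.
    exact: cvg_trans (cvg_app _ Vinf) (mD i).
  by rewrite wzx; lra.
have w0 := hD x (r - 1) xspan wz0.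
by apply/funext => g; have := w0 g; rewrite wzx; lra.
Qed.

End ClusterSequence.

(** * Mackey sets *)

(** The topology is a supremum of topologies induced by evaluations; constant functions show that
    evaluations are onto, as [cvg_image] requires. *)
Lemma ptws_cvgP (R : realType) (T : Type) (F : set_system {ptws T -> R}) (p : {ptws T -> R}) :
  Filter F -> F --> p <-> forall t, (fun g : {ptws T -> R} => g t) @ F --> p t.
Proof.
move=> FF.
have surj i : (fun g : {ptws T -> R} => g i) @` setT = setT.
  by apply/seteqP; split=> v // _; exists (cst v).
split=> [/cvg_sup Fp t|Fp].
  move/(cvg_image _ _ (surj t)): (Fp t) => h; apply: cvg_trans h => _ [W FW <-] /=.
  by apply: (@filterS _ F _ W) => // g Wg; exists g.
apply/cvg_sup => i; apply/(cvg_image _ _ (surj i)).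
move=> W /= /Fp FW; exists ((fun g : {ptws T -> R} => g i) @^-1` W) => //.
by apply/seteqP; split=> [_ [g Wg <-]//|v Wv]; exists (cst v).
Qed.

Section MackeySets.
Variables (R : realType) (X : completeNormedModType R).
Implicit Types (f z : dualT X) (phi psi : dualT X -> R) (x : X).

Definition pointwise_comb (a b : R) phi psi : dualT X -> R :=
  fun f => a * phi f + b * psi f.

Lemma compact_ultra_compact (K : set (dualT X -> R)) :
  @compact {ptws dualT X -> R} K -> ultra_compact K.
Proof.
move=> Kc U y UU Ky.
have [z Kz yz] := @ultra_compact_cvg _ {ptws dualT X -> R} U K y UU Kc Ky.
by exists z => // f; move/ptws_cvgP: yz; exact.
Qed.

(** A Mackey set through [psi]: uniform convergence on it controls the values at [psi]. *)
Definition bidual_segment psi := [set (fun f => t * psi f) | t in `[(-1 : R), 1]%classic].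

Lemma bidual_segment_mackey (Y : set (dualT X -> R)) psi :
  bidual_subspace Y -> Y psi -> mackey_sets Y (bidual_segment psi).
Proof.
move=> [_ [Y0 Ylin]] Ypsi; split; last split.
- move=> _ [t _ <-]; have := Ylin t _ _ Ypsi Y0; congr Y.
  by apply/funext => f; rewrite addr0.
- move=> a b _ _ [s s1 <-] [t t1 <-] ab; exists (a * s + b * t); last first.
    by apply/funext => f; ring.
  move: s1 t1; rewrite /= !in_itv /= -!ler_norml => s1 t1.
  rewrite (le_trans (ler_normD _ _))// !normrM; apply: le_trans ab.
  by apply: lerD; rewrite -[leRHS]mulr1 ler_wpM2l.
- pose h (t : R) : {ptws dualT X -> R} := fun f => t * psi f.
  apply: (@continuous_compact _ _ h); last exact: segment_compact.
  apply: continuous_subspaceT => t; apply/ptws_cvgP => f.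
  have : (fun s : R => s * psi f) @ t --> t * psi f by apply: cvgMr_tmp; exact: cvg_id.
  exact.
Qed.

(** This is [theta]. It is [0] by default outside the span; for [phi] outside [X],
    [span_coef_unique] makes it well defined. *)
Definition span_coef phi psi : R :=
  xget 0 [set t | exists x, psi = (fun f => 1 * embed x f + t * phi f)].

Lemma span_coefE phi x (t : R) : is_bidual phi -> (forall x, phi <> embed x) ->
  span_coef phi (fun f => 1 * embed x f + t * phi f) = t.
Proof.
move=> bp pX; rewrite /span_coef; case: xgetP => [s _ [x' hx]|/(_ t) []]; last by exists x.
apply: (span_coef_unique (x1 := x') (x2 := x) bp pX) => f.
by have := congr1 (@^~ f) hx.
Qed.

Lemma span_coef_comb phi (a b : R) psi1 psi2 : is_bidual phi ->
  (forall x, phi <> embed x) -> span_embed phi psi1 -> span_embed phi psi2 ->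
  span_coef phi (pointwise_comb a b psi1 psi2) =
    a * span_coef phi psi1 + b * span_coef phi psi2.
Proof.
move=> bp pX [x1 [t1 ->]] [x2 [t2 ->]]; rewrite !span_coefE//.
rewrite -(@span_coefE phi (a *: x1 + b *: x2) (a * t1 + b * t2))//.
by congr span_coef; apply/funext => f; rewrite /pointwise_comb /embed dualP dualZ; ring.
Qed.

Lemma span_coef_self phi : is_bidual phi -> (forall x, phi <> embed x) ->
  span_coef phi phi = 1.
Proof.
move=> bp pX; rewrite -[RHS](@span_coefE phi 0 1)//; congr span_coef.
by apply/funext => f; rewrite /embed dual0 mulr0 add0r mul1r.
Qed.

Lemma span_coef_embed phi x : is_bidual phi -> (forall x, phi <> embed x) ->
  span_coef phi (embed x) = 0.
Proof.
move=> bp pX; rewrite -[RHS](@span_coefE phi x 0)//; congr span_coef.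
by apply/funext => f; rewrite mul1r mul0r addr0.
Qed.

Lemma span_coef0 phi psi : is_bidual phi -> (forall x, phi <> embed x) ->
  span_embed phi psi -> span_coef phi psi = 0 -> exists x, psi = embed x.
Proof.
move=> bp pX [x [t ->]]; rewrite span_coefE// => ->; exists x.
by apply/funext => f; rewrite mul1r mul0r addr0.
Qed.

(** If no [z] approximates, [approx_lagrange] finds, for each finite set of functionals, an element
    of [K] killing it with coefficient above [e] in absolute value. Subtracting a multiple of it
    from a fixed [y] gives an element of [X] agreeing with [y] there, as [cluster_sequence]
    requires. *)
Lemma span_coef_approx phi (K : set (dualT X -> R)) (e : R) : is_bidual phi ->
  ~ (exists b : nat -> X, forall f, (fun n => sval f (b n)) @ \oo --> phi f) ->
  K `<=` span_embed phi -> comb_closed pointwise_comb K -> ultra_compact K -> 0 < e ->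
  exists z, forall psi, K psi -> `|psi z - span_coef phi psi| <= e.
Proof.
move=> bp nolim KY Kc Ku e0.
have pX x : phi <> embed x.
  by move=> px; apply: nolim; exists (fun _ => x) => f; rewrite px; exact: cvg_cst.
have [g0 _ _] := norming_functional (0 : X).
apply: contrapT => noz.
have large (s : seq (dualT X)) : exists psi, [/\ K psi, e < `|span_coef phi psi| &
    forall i, (i < size s)%N -> psi (nth g0 s i) = 0].
  apply: contrapT => nopsi; apply: noz.
  (* The points are elements of [K], the forms are evaluations at functionals, and every functional
     is allowed as parameter. *)
  have [|||||||z _ hz] := @approx_lagrange R (dualT X -> R) pointwise_comb (dualT X)
    (fun f psi => psi f) setT (nth g0 s) e (size s) K (span_coef phi); last first.
  - by exists z => psi Kpsi; rewrite distrC; exact: hz.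
  - move=> psi Kpsi hpsi; rewrite leNgt; apply/negP => he; apply: nopsi.
    by exists psi.
  - by move=> a b u v Ku1 Kv1 _; apply: span_coef_comb => //; exact: KY.
  - exact: Kc.
  - by [].
  - by move=> f a b u v _ _ _.
  - move=> a f g _ _; exists (dual_comb a 1 f g) => // psi /KY Ypsi.
    by rewrite bidual_comb ?mul1r//; exact: is_bidual_span Ypsi.
  - exists (dual_comb 0 0 g0 g0) => // psi /KY Ypsi.
    by rewrite bidual_comb ?mul0r ?addr0//; exact: is_bidual_span Ypsi.
have [psi0 [K0 c0 _]] := large [::].
set t0 := span_coef phi psi0 in c0.
have e20 : 0 < e / 2 by lra.
(* Rescaling to coefficient [e / 2] uses factors of size at most [1 / 2], so a difference of two
   rescaled elements stays in [K]. *)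
have small t : e < `|t| -> `|e / 2 / t| <= 1 / 2.
  move=> et; have tp : 0 < `|t| by lra.
  by rewrite normrM normfV (gtr0_norm e20) ler_pdivrMr//; lra.
have neq0 (t : R) : e < `|t| -> t != 0 by move=> et; rewrite -normr_gt0; lra.
pose y := pointwise_comb (e / 2 / t0) 0 psi0 psi0.
have Ky : K y by apply: Kc => //; rewrite normr0 addr0; have := small _ c0; lra.
have by_ := is_bidual_span bp (KY _ Ky).
have yc : span_coef phi y = e / 2.
  rewrite /y span_coef_comb ?mul0r ?addr0 ?divfK//; [exact: neq0|exact: KY|exact: KY].
have yX x : y <> embed x by move=> yx; move: yc; rewrite yx span_coef_embed//; lra.
have [s|b [z [[x [t zE]] zX bz]]] := cluster_sequence bp KY Ku by_ yX (g0 := g0).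
  have [psi [Kpsi c1 psis]] := large s; set t1 := span_coef phi psi in c1.
  pose u := pointwise_comb (e / 2 / t0) (- (e / 2 / t1)) psi0 psi.
  have Ku' : K u.
    by apply: Kc => //; rewrite normrN; have := small _ c0; have := small _ c1; lra.
  have [|x ux] := span_coef0 bp pX (KY _ Ku').
    rewrite span_coef_comb//; [|exact: KY|exact: KY].
    by rewrite -/t0 -/t1 mulNr !divfK ?subrr ?neq0.
  exists x; first by rewrite -ux.
  move=> i si; rewrite -[sval _ x]/(embed x _) -ux /u /y /pointwise_comb psis//; lra.
have t_neq0 : t != 0.
  apply/eqP => tz; apply: (zX x); rewrite zE tz.
  by apply/funext => f; rewrite mul1r mul0r addr0.
(* Solving [z = x + t phi] for [phi] turns a sequence converging to [z] into one converging to
   [phi]. *)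
apply: nolim; exists (fun n => t^-1 *: (b n - x)) => f.
have -> : (fun n => sval f (t^-1 *: (b n - x))) =
    (fun n => t^-1 * (embed (b n) f - sval f x)).
  by apply/funext => n; rewrite dualZ dualB.
have -> : phi f = t^-1 * (z f - sval f x) by rewrite zE /embed; field.
by apply: cvgMl_tmp; apply: cvgB (bz f) _; exact: cvg_cst.
Qed.

(** Nonemptiness puts [0] into [K] by [comb_closed0], so that a sum of two such sets contains
    both. *)
Definition ultra_mackey_sets phi (K : set (dualT X -> R)) :=
  [/\ K `<=` span_embed phi, comb_closed pointwise_comb K, ultra_compact K & K !=set0].

Lemma comb_closed0 (K : set (dualT X -> R)) :
  comb_closed pointwise_comb K -> K !=set0 -> K (fun=> 0).
Proof.
move=> Kc [psi Kpsi].
have -> : (fun=> 0) = pointwise_comb 0 0 psi psi by apply/funext => f; rewrite /pointwise_comb; lra.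
by apply: Kc => //; rewrite normr0 addr0.
Qed.

Lemma ultra_mackey_sets0 phi : ultra_mackey_sets phi [set (fun=> 0)].
Proof.
split; last by exists (fun=> 0).
- move=> _ ->; exists 0, 0; apply/funext => f; rewrite /embed dual0; lra.
- by move=> a b _ _ -> -> _; apply/funext => f; rewrite /pointwise_comb; lra.
- move=> U y UU y0; exists (fun=> 0) => // f.
  have -> : (fun n => y n f) = cst 0 by apply/funext => n; rewrite (y0 n).
  exact: cvg_cst.
Qed.

(** The Minkowski sum is the common upper bound; a limit of sums is found by taking limits of both
    summands along the same ultrafilter. *)
Lemma ultra_mackey_setsD phi K1 K2 : is_bidual phi ->
  ultra_mackey_sets phi K1 -> ultra_mackey_sets phi K2 ->
  exists2 K, ultra_mackey_sets phi K & K1 `|` K2 `<=` K.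
Proof.
move=> bp [Y1 c1 u1 n1] [Y2 c2 u2 n2].
exists [set psi | exists psi1 psi2, [/\ K1 psi1, K2 psi2 & psi = pointwise_comb 1 1 psi1 psi2]].
  split.
  - by move=> _ [p1 [p2 [k1 k2 ->]]]; apply: span_embed_comb; [exact: Y1|exact: Y2].
  - move=> a b _ _ [p1 [p2 [k1 k2 ->]]] [q1 [q2 [l1 l2 ->]]] ab.
    exists (pointwise_comb a b p1 q1), (pointwise_comb a b p2 q2).
    split; [exact: c1|exact: c2|].
    by apply/funext => f; rewrite /pointwise_comb; ring.
  - move=> U y UU hy.
    have /choice[p hp] n : exists p : (dualT X -> R) * (dualT X -> R),
        [/\ K1 p.1, K2 p.2 & y n = pointwise_comb 1 1 p.1 p.2].
      by have [p1 [p2 h]] := hy n; exists (p1, p2).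
    have [|z1 k1 h1] := u1 U (fun n => (p n).1) UU; first by move=> n; have [] := hp n.
    have [|z2 k2 h2] := u2 U (fun n => (p n).2) UU; first by move=> n; have [] := hp n.
    exists (pointwise_comb 1 1 z1 z2); first by exists z1, z2.
    move=> f; have -> : (fun n => y n f) = (fun n => 1 * (p n).1 f + 1 * (p n).2 f).
      by apply/funext => n; have [_ _ ->] := hp n.
    by apply: cvgD; apply: cvgMl_tmp; [exact: h1|exact: h2].
  - have [p1 k1] := n1; have [p2 k2] := n2.
    by exists (pointwise_comb 1 1 p1 p2), p1, p2.
have o1 := comb_closed0 c1 n1; have o2 := comb_closed0 c2 n2.
move=> psi [k|k]; [exists psi, (fun=> 0)|exists (fun=> 0), psi]; split=> //.
  by apply/funext => f; rewrite /pointwise_comb; lra.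
by apply/funext => f; rewrite /pointwise_comb; lra.
Qed.

Lemma mackey_ultra_mackey phi K : mackey_sets (span_embed phi) K -> K !=set0 ->
  ultra_mackey_sets phi K.
Proof. by move=> [KY [Kc Kk]] K0; split=> //; exact: compact_ultra_compact. Qed.

Definition coef_approx phi (Ke : set (dualT X -> R) * R) : set (dualT X) :=
  [set z | forall psi, Ke.1 psi -> `|psi z - span_coef phi psi| <= Ke.2].

Definition coef_filter phi : set_system (dualT X) :=
  filter_from [set Ke | ultra_mackey_sets phi Ke.1 /\ 0 < Ke.2] (coef_approx phi).

(** Basic sets are nonempty by [span_coef_approx]; two of them contain a third, for a set containing
    both [K1] and [K2] and the smaller tolerance. *)
Lemma coef_filter_proper phi : is_bidual phi ->
  ~ (exists b : nat -> X, forall f, (fun n => sval f (b n)) @ \oo --> phi f) ->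
  ProperFilter (coef_filter phi).
Proof.
move=> bp nolim; apply: filter_from_proper; last first.
  by move=> [K e] [[KY Kc Ku _] /= e0]; exact: span_coef_approx.
apply: filter_from_filter.
  by exists ([set (fun=> 0)], 1); split=> //; exact: ultra_mackey_sets0.
move=> [K1 e1] [K2 e2] [/= h1 e10] [/= h2 e20].
have [K hK K12] := ultra_mackey_setsD bp h1 h2.
exists (K, Num.min e1 e2); first by split=> //=; rewrite lt_min e10 e20.
move=> z hz; split=> psi /= kpsi.
  by have := hz psi (K12 _ (or_introl kpsi)); rewrite /= le_min => /andP[].
by have := hz psi (K12 _ (or_intror kpsi)); rewrite /= le_min => /andP[].
Qed.

End MackeySets.

(** * From Mackey completeness of the dual to weak* sequential density *)

Theorem theorem4p5 (R : realType) (X : completeNormedModType R) :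
  dual_fully_mackey_complete X ->
  forall phi : dualT X -> R, is_bidual phi ->
    exists x : nat -> X,
      forall f : dualT X, (fun n => sval f (x n)) @ \oo --> phi f.
Proof.
move=> Xfull phi bp; apply: contrapT => nolim.
have pX x : phi <> embed x.
  by move=> px; apply: nolim; exists (fun _ => x) => f; rewrite px; exact: cvg_cst.
have Ysub := span_embed_subspace bp.
have FP := coef_filter_proper bp nolim.
have [|z0 hz0] := Xfull _ Ysub (span_embed_closed bp pX) (span_embed_norming bp) _ FP.
  move=> K Km e e0; have [K0|K0] := pselect (K !=set0); last first.
    exists setT; first exact: filterT.
    by move=> z1 z2 _ _ psi Kpsi; case: K0; exists psi.
  have e20 : 0 < e / 2 by lra.
  exists (coef_approx phi (K, e / 2)).
    by exists (K, e / 2) => //; split=> //; exact: mackey_ultra_mackey.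
  move=> z1 z2 h1 h2 psi Kpsi; rewrite -(subrKA (span_coef phi psi)).
  rewrite (le_trans (ler_normD _ _))// [leRHS]splitr; apply: lerD; first exact: h1.
  by rewrite distrC; exact: h2.
(* Near the filter, [z] is close to [z0] on the segment of [psi] and also approximates [theta]
   there, so [z0] represents [theta] exactly. *)
have val psi : span_embed phi psi -> psi z0 = span_coef phi psi.
  move=> Ypsi; apply/eqP; rewrite -subr_eq0 -normr_le0.
  apply/ler_addgt0Pr => e e0; rewrite add0r; have e20 : 0 < e / 2 by lra.
  have Km := bidual_segment_mackey Ysub Ypsi.
  have Kpsi : bidual_segment psi psi.
    exists 1; last by apply/funext => f; rewrite mul1r.
    by rewrite /= in_itv /= lexx andbT; lra.
  have Fz : coef_filter phi (coef_approx phi (bidual_segment psi, e / 2)).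
    exists (bidual_segment psi, e / 2) => //; split=> //.
    by apply: mackey_ultra_mackey => //; exists psi.
  have /filter_ex[z [/(_ _ Kpsi) h1 /(_ _ Kpsi) h2]] :=
    @filterI _ _ FP _ _ (hz0 _ Km _ e20) Fz.
  rewrite -(subrKA (psi z)) (le_trans (ler_normD _ _))// [leRHS]splitr.
  by apply: lerD => //; rewrite distrC.
have phi1 := val _ (self_in_span phi); rewrite span_coef_self// in phi1.
(* As [theta] vanishes on [X], [z0] is the zero functional, contradicting [phi z0 = 1]. *)
have z00 x : sval z0 x = 0 by rewrite -[LHS]/(embed x z0) (val _ (embed_in_span phi x)) span_coef_embed.
have : phi z0 = 0 * phi z0 by apply: bidualZ => // x; rewrite z00 mul0r.
by rewrite phi1; lra.
Qed.
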